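(* Let $G$ be a finitely generated group and let $A$ be a finite vector space. Then the following two assertions are equivalent: (a) every linear NUCA $\sigma_s\colon A^G\to A^G$ of finite memory with uniformly bounded singularity which is stably injective is stably invertible; (b) every linear NUCA $\sigma_s\colon A^G\to A^G$ of finite memory with uniformly bounded singularity which is stably post-surjective is stably invertible.
   Context: For a set $B$, $B^G$ is the set of maps (configurations) $G\to B$, with the prodiscrete topology (product of discrete topologies) and the shift action $(gx)(h)=x(g^{-1}h)$ for $g,h\in G$, $x\in B^G$. For $x\in B^G$, $\Sigma(x)=\overline{\{gx: g\in G\}}\subset B^G$. Two configurations $x,y\in B^G$ are asymptotic if $x|_{G\setminus E}=y|_{G\setminus E}$ for some finite $E\subset G$. For a subset $M\subset G$ (a memory), $S=A^{A^M}$ is the set of all maps $A^M\to A$. For $s\in S^G$, the non-uniform cellular automaton (NUCA) $\sigma_s\colon A^G\to A^G$ is defined by $\sigma_s(x)(g)=s(g)\big((g^{-1}x)|_M\big)$ for $x\in A^G$, $g\in G$. It has finite memory if $M$ is finite. It is linear if it is a linear map of vector spaces $A^G\to A^G$ (component-wise operations), equivalently if all $s(g)\colon A^M\to A$ are linear. $\sigma_s$ (or $s$) has uniformly bounded singularity if for every finite $E\subset G$ with $1_G\in E=E^{-1}$ there is a finite $F\subset G$ containing $E$ such that the restriction $s|_{FE\setminus F}$ is constant. $\sigma_s$ is post-surjective if for all $x,y\in A^G$ with $y$ asymptotic to $\sigma_s(x)$, there is $z\in A^G$ asymptotic to $x$ with $\sigma_s(z)=y$. $\sigma_s$ is stably injective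 (resp. stably post-surjective) if $\sigma_p$ is injective (resp. post-surjective) for every $p\in\Sigma(s)\subset S^G$. $\sigma_s$ is stably invertible if there exist a finite set $N\subset G$ and $t\in T^G$, where $T=A^{A^N}$, such that for every $p\in\Sigma(s)$ there is some $q\in\Sigma(t)$ with $\sigma_p\circ\sigma_q=\sigma_q\circ\sigma_p=\mathrm{Id}$. *)

(* Defs.v *)
From HB Require Import structures.
From mathcomp Require Import all_boot all_order all_algebra.
From mathcomp Require Import monoid finalg.
From mathcomp Require Import all_classical topology.

Set Implicit Arguments.
Unset Strict Implicit.
Unset Printing Implicit Defensive.

Import GRing.Theory.

Local Open Scope classical_set_scope.

Definition finitely_generated (G : groupType) : Prop :=
  exists2 X : set G, finite_set X &
    smallest [set H : set G | group_closed (mem H)] X = [set: G].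

Definition set_mulg (G : groupType) (X Y : set G) : set G :=
  [set (x * y)%g | x in X & y in Y].

Definition shift (G : groupType) (B : Type) (g : G) (x : G -> B) : G -> B :=
  fun h => x (g^-1 * h)%g.

(* The closure is taken in the prodiscrete topology: pointwise convergence
   with [B] discrete. *)
Definition orbit_closure (G : groupType) (B : choiceType) (x : G -> B) :
    set (G -> B) :=
  closure ([set shift g x | g in [set: G]] :
             set {ptws G -> discrete_topology B}).

Definition asymptotic (G : groupType) (B : Type) (x y : G -> B) : Prop :=
  exists2 E : set G, finite_set E & forall g, ~ E g -> x g = y g.

(* [S = A^(A^M)]; the subset [M] of [G] is used as a type. *)
Definition local_map (G : groupType) (A : Type) (M : set G) : Type :=
  (M -> A) -> A.

HB.instance Definition _ (G : groupType) (A : choiceType) (M : set G) :=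
  Choice.copy (local_map A M) ((M -> A) -> A).

Section NUCA.
Variables (G : groupType) (A : choiceType).
Implicit Types M N : set G.

Definition nuca M (s : G -> local_map A M) (x : G -> A) : G -> A :=
  fun g => s g (sigL M (shift g^-1%g x)).

Definition uniformly_bounded_singularity M (s : G -> local_map A M) : Prop :=
  forall E : set G, finite_set E -> E 1%g -> E = [set x^-1%g | x in E] ->
    exists F : set G, [/\ finite_set F, E `<=` F &
      exists c : local_map A M,
        forall g, (set_mulg F E `\` F) g -> s g = c].

Definition post_surjective (f : (G -> A) -> G -> A) : Prop :=
  forall x y : G -> A, asymptotic y (f x) ->
    exists2 z : G -> A, asymptotic z x & f z = y.

Definition stably_injective M (s : G -> local_map A M) : Prop :=
  forall p, orbit_closure s p -> injective (nuca p).

Definition stably_post_surjective M (s : G -> local_map A M) : Prop :=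
  forall p, orbit_closure s p -> post_surjective (nuca p).

Definition stably_invertible M (s : G -> local_map A M) : Prop :=
  exists N : set G, finite_set N /\
    exists t : G -> local_map A N,
      forall p, orbit_closure s p ->
        exists2 q, orbit_closure t q &
          nuca p \o nuca q = id /\ nuca q \o nuca p = id.

End NUCA.

(* [G -> A] carries the pointwise [k]-module structure. *)
Definition linear_nuca (G : groupType) (k : fieldType) (A : lmodType k)
    (M : set G) (s : G -> local_map A M) : Prop :=
  linear (nuca s : (G -> A) -> (G -> A)).

(* Main.v *)
From HB Require Import structures.
Require Import Defs.
From mathcomp Require Import all_boot all_order all_algebra.
From mathcomp Require Import monoid finalg finmap.
From mathcomp Require Import all_classical topology.

(** Both assertions are exchanged by transposition. A linear automaton
[nuca s] of finite memory is a row-finite and column-finite matrix indexed by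
[G * G], with entries in the endomorphisms of [A]; its transpose is again a
linear automaton [nuca (dual N s)], with memory the set [N] of inverses of the
memory of [s]. Transposition is taken with respect to a nondegenerate symmetric
bilinear form on [A], summed over [G] into a pairing between finitely supported
and arbitrary configurations ([pairing_dual]), so that the transpose lives over
[A] itself rather than over its dual space.

Post-surjectivity of a linear automaton is surjectivity on finitely supported
configurations, and all configurations form the full linear dual of the finitely
supported ones. Hence the transpose of a post-surjective automaton is injective
([injective_dual]), and the transpose of an injective one is post-surjective:
otherwise a linear functional killing the image of the finitely supported
configurations, given by Zorn's lemma, would be a nonzero configuration in the
kernel ([post_surjective_dual]).

The value of [dual N s] at [h] depends only on the pattern of [s] around [h], in
a translation-invariant way ([dual_local]). So transposition is compatible with
orbit closures and with uniformly bounded singularity, and being involutive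
([dualK]) it identifies the orbit closures of [s] and of its transpose. The
conditions required for every configuration of the orbit closure are therefore
exchanged as well.

It remains to carry stable invertibility back from the transpose to [s]. The
local maps of an inverse need be linear only along those configurations that
do invert something, so the inverse provided by stable invertibility cannot be
transposed as it stands. But one two-sided inverse of [nuca s] is
enough ([stably_invertible_of_inverse]): its local map at [g] is determined by
the pattern of [s] around [g] ([nuca_inverse_local]), so the same recipe inverts
every configuration of the orbit closure. *)

Set Implicit Arguments.
Unset Strict Implicit.
Unset Printing Implicit Defensive.

Import GRing.Theory.

Local Open Scope classical_set_scope.
Local Open Scope ring_scope.

(** * Orbit closures *)

(** Finite windows are a base of the prodiscrete topology; this form of the
orbit closure is the only one used below. *)
Lemma orbit_closureP (G : groupType) (B : choiceType) (x p : G -> B) :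
  orbit_closure x p <->
  forall E : set G, finite_set E ->
    exists g : G, forall h, E h -> p h = shift g x h.
Proof.
pose K (_ : G) : topologicalType := discrete_topology B.
split.
- move=> clp E /finite_fsetP[X ->].
  have nC : nbhs (p : {ptws G -> discrete_topology B})
              (\bigcap_(h in [set` X]) [set f | f h = p h]).
    apply: (@filter_bigI _ _ _ _ _ (@nbhs_filter (prod_topology K) p)) => h _.
    apply: (@proj_continuous G K h (p : prod_topology K) [set p h]).
    exact: (@discrete_set1 (discrete_topology B)).
  by have [_ [[g _ <-] gC]] := clp _ nC; exists g => h /gC /= ->.
- move=> approx C nC.
  pose cyl (E : set G) : set (prod_topology K) :=
    [set f | forall h, E h -> f h = p h].
  pose F : set_system (prod_topology K) :=
    [set D | exists2 E, finite_set E & cyl E `<=` D].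
  have filterF : Filter F.
    split.
    + by exists set0 => //; exact: finite_set0.
    + move=> D1 D2 [E1 fin1 sub1] [E2 fin2 sub2]; exists (E1 `|` E2).
        by rewrite finite_setU.
      by move=> f fE; split; [apply: sub1|apply: sub2] => h Eh; apply: fE;
        [left|right].
    + by move=> D1 D2 sub12 [E finE sub]; exists E => // f /sub /sub12.
  (* Convergence in a product can be tested on each coordinate separately. *)
  have cvgF : F --> (p : prod_topology K).
    apply/cvg_sup => h D /=; rewrite (@nbhsE (initial_topology _)).
    move=> [U [[V _ <-] Vp] subD].
    exists [set h]; first exact: finite_set1.
    by move=> f fh; apply: subD; rewrite /preimage /= fh.
  have [E finE sub] := cvgF C nC.
  have [g gE] := approx E finE.
  by exists (shift g x); split; [exists g | apply: sub => h Eh; rewrite gE].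
Qed.

Lemma orbit_closure_refl (G : groupType) (B : choiceType) (x : G -> B) :
  orbit_closure x x.
Proof.
by apply/orbit_closureP => E _; exists 1%g => h _; rewrite /shift invg1 mul1g.
Qed.

(** * Two-sided inverses *)

Section Automata.
Variables (G : groupType) (A : choiceType).
Implicit Types (M N : set G) (x y : G -> A).

Lemma eq_nuca M (s s' : G -> local_map A M) x x' (g g' : G) :
  s g = s' g' -> (forall m, M m -> x (g * m)%g = x' (g' * m)%g) ->
  nuca s x g = nuca s' x' g'.
Proof.
move=> eq_s eq_x; rewrite /nuca eq_s; congr (s' g' _).
apply/funext => -[m Mm] /=; rewrite /shift !invgK.
exact/eq_x/set_mem/Mm.
Qed.

Lemma nuca_shift M (s : G -> local_map A M) g x :
  nuca (shift g s) (shift g x) = shift g (nuca s x).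
Proof.
by apply/funext => h; apply: eq_nuca => // m _; rewrite /shift mulgA.
Qed.

Lemma finite_set_mulg (X Y : set G) :
  finite_set X -> finite_set Y -> finite_set (set_mulg X Y).
Proof. exact: finite_image2. Qed.

(** The local rule [t g], used at [h], still recovers [y h] from [nuca s y]:
the part of [nuca s y] seen from [h] is, up to translation, the part seen from
[g] of the image of a translate of [y]. As [nuca s] is onto, this determines
[t h]. *)
Lemma nuca_inverse_local M N (s : G -> local_map A M) (t : G -> local_map A N)
    (st : nuca s \o nuca t = id) (ts : nuca t \o nuca s = id) (g h : G) :
  (forall n, N n -> s (g * n)%g = s (h * n)%g) -> t g = t h.
Proof.
move=> eq_s; apply/funext => a.
(* The pattern [a] itself provides the default value [t g a] outside [N]; no
   point of [A] is available otherwise. *)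
pose z := shift h (valL_ (t g a) a).
have za : sigL N (shift h^-1%g z) = a.
  rewrite -[RHS](valLK (t g a)); congr (sigL N _).
  by apply/funext => n; rewrite /z /shift invgK mulKg.
pose y := nuca t z; pose y' := shift (g * h^-1)%g y.
have syz : nuca s y = z by have := congr1 (@^~ z) st.
have ty'g : nuca t (nuca s y') g = t g a.
  rewrite /nuca -/(nuca s y'); congr (t g _); rewrite -[in RHS]za -[in RHS]syz.
  apply/funext => -[n Nn] /=; rewrite /shift !invgK.
  apply: eq_nuca; first exact/eq_s/set_mem/Nn.
  by move=> m _; rewrite /y' /shift !(invgM, invgK, mulgA) mulgVK.
have tyh : nuca t (nuca s y) h = t h a by rewrite syz /nuca za.
have tsE u : nuca t (nuca s u) = u by have := congr1 (@^~ u) ts.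
by rewrite -ty'g -tyh !tsE /y' /shift !(invgM, invgK) mulgVK.
Qed.

(** Every finite window of [p] is a window of [s], and [t] at a point is a
function of a window of [s]: evaluating this function along [p] gives [q]. On
any finite set the pair [(p, q)] is a translate of [(s, t)], and being
two-sided inverses is a condition on finite windows. *)
Lemma stably_invertible_of_inverse M N
    (s : G -> local_map A M) (t : G -> local_map A N) :
  finite_set M -> finite_set N ->
  nuca s \o nuca t = id -> nuca t \o nuca s = id -> stably_invertible s.
Proof.
move=> finM finN st ts; exists N; split => //.
exists t => p /orbit_closureP clp.
have finhN h : finite_set (set_mulg [set h] N).
  by apply: finite_set_mulg => //; exact: finite_set1.
have /choice[w wP] (h : G) : exists g, forall n, N n ->
    p (h * n)%g = s (g * n)%g.
  have [g gP] := clp _ (finhN h); exists (g^-1 * h)%g => n Nn.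
  rewrite (gP (h * n)%g) /shift ?mulgA //.
  by exists h => //; exists n.
pose q h := t (w h).
have approx E : finite_set E ->
    exists g, forall h, E h -> p h = shift g s h /\ q h = shift g t h.
  move=> finE.
  have [|g gP] := clp (E `|` set_mulg E N).
    by rewrite finite_setU; split => //; exact: finite_set_mulg.
  exists g => h Eh; split; first by apply: gP; left.
  apply: (nuca_inverse_local st ts) => n Nn.
  rewrite -wP // gP; last by right; exists h => //; exists n.
  by rewrite /shift mulgA.
exists q.
  apply/orbit_closureP => E /approx[g gP]; exists g => h Eh.
  by have [] := gP h Eh.
have key (x : G -> A) (h : G) : nuca p (nuca q x) h = x h /\
    nuca q (nuca p x) h = x h.
  have [|g gP] := approx ([set h] `|`
      (set_mulg [set h] M `|` set_mulg [set h] N)).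
    by rewrite !finite_setU; do 2?split; try exact: finite_set1;
      apply: finite_set_mulg => //; exact: finite_set1.
  have [ph qh] : p h = shift g s h /\ q h = shift g t h by apply: gP; left.
  have {}gP k K : M k \/ N k -> K = (h * k)%g ->
      p K = shift g s K /\ q K = shift g t K.
    move=> Mk ->; apply: gP; right.
    by case: Mk => ?; [left|right]; exists h => //; exists k.
  pose x' := shift g^-1%g x.
  have x'E : x = shift g x'.
    by apply/funext => k; rewrite /x' /shift invgK mulVKg.
  split.
    transitivity (nuca (shift g s) (nuca (shift g t) x) h).
      apply: eq_nuca => // m Mm; apply: eq_nuca => //.
      by have [] := gP m _ (or_introl Mm) erefl.
    rewrite x'E !nuca_shift.
    by have /= -> := congr1 (@^~ x') st.
  transitivity (nuca (shift g t) (nuca (shift g s) x) h).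
    apply: eq_nuca => // m Mm; apply: eq_nuca => //.
    by have [] := gP m _ (or_intror Mm) erefl.
  rewrite x'E !nuca_shift.
  by have /= -> := congr1 (@^~ x') ts.
by split; apply/funext => x; apply/funext => h; have [] := key x h.
Qed.

End Automata.

(** * Linear algebra *)

(** A subset maximal among the subspaces that contain [W] and avoid [v] is a
complement of the line of [v]; the functional is the coordinate along [v]. *)
Lemma separating_functional (k : fieldType) (U : lmodType k) (W : set U)
    (v : U) :
  W 0 -> (forall c u w, W u -> W w -> W (c *: u + w)) -> ~ W v ->
  exists phi : U -> k,
    [/\ scalar phi, forall w, W w -> phi w = 0 & phi v = 1].
Proof.
move=> W0 Wlin Wv.
(* The empty set has to satisfy [P], as the union of the empty chain; hence [W]
   is only required to lie in [X] when [X] is nonempty. *)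
pose P (X : set U) := [/\ forall c u w, X u -> X w -> X (c *: u + w),
  forall u, X u -> W `<=` X & ~ X v].
have [X [[Xlin XW Xv] Xmax]] : exists X, P X /\ forall Y, X `<` Y -> ~ P Y.
  apply: Zorn_bigcup => F FP Ftot; split.
  - move=> c u w [X FX Xu] [Y FY Yw].
    have [XY|YX] := Ftot _ _ FX FY.
      exists Y => //; have [Ylin _ _] := FP _ FY.
      by apply: Ylin => //; exact: XY.
    exists X => //; have [Xlin _ _] := FP _ FX.
    by apply: Xlin => //; exact: YX.
  - move=> u [X FX Xu] w Ww; exists X => //.
    by have [_ /(_ u Xu w Ww)] := FP _ FX.
  - by move=> [X FX Xv]; have [_ _] := FP _ FX; exact.
have {}XW : W `<=` X.
  have [u Xu] : exists u, X u.
    apply: contrapT => noX; apply: (Xmax W); last by split => // ? _.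
    split=> [u Xu|/(_ 0 W0) X0]; first by case: noX; exists u.
    by apply: noX; exists 0.
  exact: XW Xu.
have X0 : X 0 := XW _ W0.
have XZ c u : X u -> X (c *: u).
  by move=> Xu; rewrite -[_ *: _]addr0; exact: Xlin.
have /choice[phi phiP] u : exists c, X (u - c *: v).
  have [Xu|Xu] := pselect (X u); first by exists 0; rewrite scale0r subr0.
  pose Y : set U := [set y | exists2 w, X w & exists c, y = w + c *: u].
  have XY : X `<=` Y.
    by move=> w Xw; exists w => //; exists 0; rewrite scale0r addr0.
  have [w Xw [c vE]] : Y v.
    apply: contrapT => Yv; apply: (Xmax Y).
      split=> // YX; apply/Xu/YX.
      by exists 0 => //; exists 1; rewrite scale1r add0r.
    split => // [c y z [w Xw [d ->]] [w' Xw' [d' ->]]|y _].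
      exists (c *: w + w'); first exact: Xlin.
      by exists (c * d + d'); rewrite scalerDr scalerA scalerDl addrACA.
    exact: subset_trans XW XY.
  have c0 : c != 0.
    by apply/eqP => c0; apply: Xv; rewrite vE c0 scale0r addr0.
  exists c^-1; rewrite vE scalerDr scalerA mulVf // scale1r.
  rewrite opprD addrCA subrr addr0.
  by rewrite -scaleNr; exact: XZ.
have phi_uniq u c : X (u - c *: v) -> phi u = c.
  move=> Xu; apply/eqP; rewrite -subr_eq0; apply: contrapT => /negP d0.
  apply: Xv; suff : X ((phi u - c) *: v).
    by move/(XZ (phi u - c)^-1); rewrite scalerA mulVf // scale1r.
  have := Xlin (-1) _ _ (phiP u) Xu.
  by rewrite scaleN1r opprB addrA subrK scalerBl.
exists phi; split.
- move=> c u w; apply: phi_uniq.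
  have := Xlin c _ _ (phiP u) (phiP w).
  by rewrite scalerBr scalerA addrACA -opprD -scalerDl.
- by move=> w Ww; apply: phi_uniq; rewrite scale0r subr0; exact: XW.
- by apply: phi_uniq; rewrite scale1r subrr.
Qed.

(** A nondegenerate symmetric form together with a representation of all linear
functionals. [riesz] is total for convenience and is meaningful on linear
functionals only. *)
Record self_duality (k : fieldType) (A : lmodType k) := SelfDuality {
  dform : A -> A -> k;
  dformC : forall a b, dform a b = dform b a;
  dform_scalar : forall b, scalar (dform^~ b);
  riesz : (A -> k) -> A;
  dform_riesz : forall phi : A -> k, scalar phi ->
    forall b, dform b (riesz phi) = phi b;
  dform_inj : forall a b, (forall c, dform c a = dform c b) -> a = b }.

(** A spanning family of least size is a basis. *)
Lemma finLmod_basis (k : fieldType) (A : finLmodType k) :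
  exists (n : nat) (e : 'I_n -> A) (c : A -> 'I_n -> k),
    forall a d, a = \sum_i d i *: e i <-> d = c a.
Proof.
pose P n := `[< exists e : 'I_n -> A, forall a,
  exists d : 'I_n -> k, a = \sum_i d i *: e i >].
have exP : exists n, P n.
  exists #|A|; apply/asboolP; exists (fun i => enum_val i) => a.
  exists (fun i => (i == enum_rank a)%:R).
  rewrite (bigD1 (enum_rank a)) //= eqxx scale1r enum_rankK big1 ?addr0 //.
  by move=> i /negPf ->; rewrite scale0r.
case: (ex_minnP exP) => n /asboolP[e /choice[c cP]] minn.
exists n, e, c => a d; split=> [aE|->]; last exact: cP.
apply: contrapT => neq_dc.
have [j dj] : exists j, d j - c a j != 0.
  apply: contrapT => /forallNP eq_dc; apply: neq_dc; apply/funext => j.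
  by apply/eqP; rewrite -subr_eq0; apply: contrapT => /negP /(eq_dc j).
case: n e minn c cP d aE neq_dc j dj => [e _ c cP d _ _ []//|n].
move=> e minn c cP d aE _ j dj.
have sum0 : \sum_i (d i - c a i) *: e i = 0.
  under eq_bigr do rewrite scalerBl.
  by rewrite sumrB -aE -cP subrr.
(* A nontrivial relation expresses [e j] by the other vectors, which would
   then form a smaller spanning family. *)
have ejE : e j = \sum_(i < n)
    (- (d j - c a j)^-1 * (d (lift j i) - c a (lift j i))) *: e (lift j i).
  apply: (scalerI dj); rewrite scaler_sumr.
  under eq_bigr do rewrite scalerA mulrA mulrN mulfV // mulN1r scaleNr.
  rewrite sumrN; apply/eqP; rewrite -addr_eq0; apply/eqP.
  by rewrite -[RHS]sum0 (bigD1_ord j).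
suff /minn : P n by rewrite ltnn.
apply/asboolP; exists (fun i => e (lift j i)) => b.
exists (fun i => c b (lift j i) +
  c b j * (- (d j - c a j)^-1 * (d (lift j i) - c a (lift j i)))).
rewrite [LHS]cP (bigD1_ord j) //= {1}ejE scaler_sumr -big_split /=.
by apply: eq_bigr => i _; rewrite scalerA -scalerDl addrC.
Qed.

(** The form is the one for which the chosen basis is orthonormal. *)
Lemma finLmod_self_duality (k : fieldType) (A : finLmodType k) :
  exists _ : self_duality A, True.
Proof.
have [n [e [c cP]]] := finLmod_basis A.
have eqc a d : a = \sum_i d i *: e i -> c a = d by move/cP.
have cE a : a = \sum_i c a i *: e i by apply/cP.
have c_lin r a b i : c (r *: a + b) i = r * c a i + c b i.
  rewrite (eqc _ (fun i => r * c a i + c b i)) //.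
  rewrite {1}[a]cE {1}[b]cE scaler_sumr -big_split.
  by apply: eq_bigr => j _; rewrite scalerDl scalerA.
have c_e i j : c (e i) j = (j == i)%:R.
  rewrite (eqc _ (fun j => (j == i)%:R)) // (bigD1 i) //= eqxx scale1r.
  by rewrite big1 ?addr0 // => l /negPf ->; rewrite scale0r.
pose B a b := \sum_i c a i * c b i.
have B_e i b : B (e i) b = c b i.
  rewrite /B (bigD1 i) //= c_e eqxx mul1r big1 ?addr0 // => j /negPf ji.
  by rewrite c_e ji mul0r.
have B_lin b : scalar (B^~ b).
  move=> r a a'; rewrite /B mulr_sumr -big_split /=.
  by apply: eq_bigr => i _; rewrite c_lin mulrDl mulrA.
unshelve eexists => //.
apply: (@SelfDuality _ _ B _ B_lin (fun phi => \sum_i phi (e i) *: e i)).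
- by move=> a b; apply: eq_bigr => i _; rewrite mulrC.
- move=> phi phi_lin b.
  pose f : {scalar A} := HB.pack phi
    (GRing.isLinear.Build k A k *%R phi phi_lin).
  transitivity (f (\sum_i c b i *: e i)); last by rewrite -cE.
  rewrite linear_sum /B; apply: eq_bigr => i _.
  by rewrite linearZ [c (\sum_(_ < _) _)](eqc _ (fun i => phi (e i))).
- move=> a b eqB; rewrite [a]cE [b]cE; apply: eq_bigr => i _.
  by rewrite -B_e eqB B_e.
Qed.

(** * Linear automata and finitely supported configurations *)

Section LinearAutomata.
Variables (G : groupType) (k : fieldType) (A : lmodType k).
Implicit Types (M N : set G) (x y : G -> A) (a b : A) (g h : G).

Definition delta h a : G -> A := fun g => if g == h then a else 0.

Lemma delta_linear h : linear (delta h).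
Proof.
move=> c a b; apply/funext => g; rewrite /delta.
rewrite [RHS](_ : _ =
  c *: (if g == h then a else 0) + if g == h then b else 0) //.
by case: ifP => // _; rewrite scaler0 addr0.
Qed.

Lemma asymptotic0_delta h a : asymptotic (delta h a) 0.
Proof.
exists [set h]; first exact: finite_set1.
by move=> g gh; rewrite /delta; case: eqP.
Qed.

Lemma asymptotic0_lin c x y :
  asymptotic x 0 -> asymptotic y 0 -> asymptotic (c *: x + y) 0.
Proof.
move=> [E finE xE] [F finF yF]; exists (E `|` F); first by rewrite finite_setU.
move=> g /not_orP[Eg Fg].
rewrite (_ : (c *: x + y) g = c *: x g + y g) // xE // yF //.
by rewrite scaler0 addr0.
Qed.

Lemma asymptotic00 : asymptotic (0 : G -> A) 0.
Proof. by exists set0 => //; exact: finite_set0. Qed.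

(** The scalar [1] puts the induction step in the form [c *: x + y] to which
linearity statements apply. *)
Lemma asymptotic0_ind (P : (G -> A) -> Prop) :
  P 0 -> (forall h a x, asymptotic x 0 -> P x -> P (1 *: delta h a + x)) ->
  forall x, asymptotic x 0 -> P x.
Proof.
move=> P0 Pdelta x [E /finite_seqP[r ->]] xE.
elim: r x xE => [|h r IHr] x xE.
  by rewrite (_ : x = 0) //; apply/funext => g; apply: xE.
pose x' g := if g == h then 0 else x g.
have x'E g : g \notin r -> x' g = 0.
  rewrite /x'; case: eqP => // /eqP gh gr; apply: xE.
  by rewrite /= inE (negPf gh) (negPf gr).
have -> : x = 1 *: delta h (x h) + x'.
  apply/funext => g; rewrite scale1r.
  rewrite [RHS](_ : _ = delta h (x h) g + x' g) // /delta /x'.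
  by case: eqP => [->|_]; rewrite ?addr0 ?add0r.
apply: Pdelta; first by exists [set` r] => // g /negP; exact: x'E.
by apply: IHr => g /negP; exact: x'E.
Qed.

Section LinearNuca.
Variables (M : set G) (s : G -> local_map A M).
Hypothesis s_lin : linear_nuca s.

Lemma linear_nuca0 : nuca s 0 = 0.
Proof.
have := s_lin (-1) 0 0; rewrite scaleN1r addNr => ->.
by rewrite scaleN1r addNr.
Qed.

Lemma linear_nuca_eq0 x g :
  (forall m, M m -> x (g * m)%g = 0) -> nuca s x g = 0.
Proof.
move=> xM; rewrite -[RHS]/((0 : G -> A) g) -linear_nuca0.
exact: eq_nuca.
Qed.

Lemma asymptotic0_nuca x :
  finite_set M -> asymptotic x 0 -> asymptotic (nuca s x) 0.
Proof.
move=> finM [E finE xE].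
exists (set_mulg E [set m^-1%g | m in M]).
  by apply: finite_set_mulg => //; exact: finite_image.
move=> g Eg; apply: linear_nuca_eq0 => m Mm; apply: xE => Egm; apply: Eg.
by exists (g * m)%g => //; exists m^-1%g; [exists m|rewrite mulgK].
Qed.

(** At each point, an automaton of the orbit closure acts as some translate of
[nuca s]. *)
Lemma linear_nuca_orbit_closure p : orbit_closure s p -> linear_nuca p.
Proof.
move=> /orbit_closureP clp c x y; apply/funext => h.
have [g ph] := clp [set h] (finite_set1 h).
have pE z : nuca p z h = shift g (nuca s (shift g^-1%g z)) h.
  rewrite -nuca_shift; apply: eq_nuca; first exact: ph.
  by move=> m _; rewrite /shift invgK mulVKg.
rewrite [RHS](_ : _ = c *: nuca p x h + nuca p y h) // !pE.
rewrite [in LHS](_ : shift g^-1%g _ =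
  c *: shift g^-1%g x + shift g^-1%g y) //.
by rewrite s_lin.
Qed.

End LinearNuca.

Lemma linear_nuca_inv M N (s : G -> local_map A M) (t : G -> local_map A N) :
  linear_nuca s -> nuca s \o nuca t = id -> nuca t \o nuca s = id ->
  linear_nuca t.
Proof.
move=> s_lin st ts c x y.
have stE z : nuca s (nuca t z) = z by have := congr1 (@^~ z) st.
have tsE z : nuca t (nuca s z) = z by have := congr1 (@^~ z) ts.
by rewrite -[in LHS](stE x) -[in LHS](stE y) -s_lin tsE.
Qed.

(** * The pairing of configurations *)

Variable D : self_duality A.

(** Meaningful when one of the configurations is finitely supported: the sum
over a set with infinitely many nonzero terms is zero by convention. *)
Definition pairing x y : k := \sum_(g \in [set: G]) dform D (x g) (y g).

Lemma dform0l b : dform D 0 b = 0.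
Proof.
by have := dform_scalar D b (-1) 0 0; rewrite scaleN1r addNr mulN1r addNr.
Qed.

Lemma pairing_finite x y (E : set G) : finite_set E ->
  (forall g, ~ E g -> x g = 0) ->
  pairing x y = \sum_(g <- fset_set E) dform D (x g) (y g).
Proof.
move=> finE xE; rewrite -fsbig_finite //; apply/esym/fsbig_widen => //.
by move=> g [_ /xE xg] /=; rewrite xg dform0l.
Qed.

Lemma pairingC x y : pairing x y = pairing y x.
Proof. by apply: eq_fsbigr => g _; rewrite dformC. Qed.

Lemma pairing_linl c x x' y : asymptotic x 0 -> asymptotic x' 0 ->
  pairing (c *: x + x') y = c * pairing x y + pairing x' y.
Proof.
move=> [E finE xE] [F finF x'F].
have finEF : finite_set (E `|` F) by rewrite finite_setU.
rewrite !(pairing_finite _ finEF).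
- rewrite mulr_sumr -big_split /=; apply: eq_bigr => g _.
  exact: dform_scalar.
- by move=> g /not_orP[_]; exact: x'F.
- by move=> g /not_orP[+ _]; exact: xE.
- move=> g /not_orP[Eg Fg].
  rewrite (_ : (c *: x + x') g = c *: x g + x' g) // xE // x'F //.
  by rewrite scaler0 addr0.
Qed.

Lemma pairing_linr c x y y' : asymptotic x 0 ->
  pairing x (c *: y + y') = c * pairing x y + pairing x y'.
Proof.
move=> [E finE xE]; rewrite !(pairing_finite _ finE) // mulr_sumr -big_split /=.
by apply: eq_bigr => g _; rewrite ![dform D (x g) _]dformC dform_scalar.
Qed.

Lemma pairing_delta h a y : pairing (delta h a) y = dform D a (y h).
Proof.
rewrite (@pairing_finite _ _ [set h]); last 2 first.
- exact: finite_set1.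
- by move=> g gh; rewrite /delta; case: eqP.
by rewrite fset_set1 big_seq_fset1 /delta eqxx.
Qed.

Lemma pairing_shift g x y : pairing (shift g x) (shift g y) = pairing x y.
Proof.
rewrite /pairing [RHS](reindex_fsbigT (fun h => g^-1 * h)%g) //.
by exists (fun h => g * h)%g => h; rewrite ?mulKg ?mulVKg.
Qed.

Lemma pairing0l y : pairing 0 y = 0.
Proof. by rewrite /pairing fsbig1 // => g _; rewrite dform0l. Qed.

Lemma pairing_inj y y' :
  (forall h b, pairing (delta h b) y = pairing (delta h b) y') -> y = y'.
Proof.
move=> eq_yy'; apply/funext => h; apply: (dform_inj (s := D)) => b.
by rewrite -!pairing_delta.
Qed.

(** * The transposed automaton *)

(** The value at [h] is the vector representing the functional that sends [b]
to the pairing of [nuca s (delta h b)] with the configuration. Everything is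
translated back to the identity so that [dual_local] holds by mere
inspection. *)
Definition dual M N (s : G -> local_map A M) : G -> local_map A N :=
  fun h (u : N -> A) => riesz D (fun b =>
    pairing (shift h^-1%g (nuca s (delta h b))) (valL_ 0 u)).
Arguments dual {M} N s.

Lemma valL_out N (z : A) (a : N -> A) g : ~ N g -> valL_ z a g = z.
Proof.
by move=> Ng; rewrite /valL_ oinv_set_val /= insubN //; apply/negP; rewrite inE.
Qed.

Lemma valL_sigL N (z : A) x g : N g -> valL_ z (sigL N x) g = x g.
Proof.
move=> Ng.
have /(congr1 (fun f => f g)) /= -> := congr1 (@^~ x) (sigLK z (A := N)).
by rewrite /patch mem_set.
Qed.

(** The factor [valL_ 0 u] restricts the pairing to [N], and there [nuca s] only
involves the values of [s] on [h N]. *)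
Lemma dual_local M N (s s' : G -> local_map A M) h h' :
  (forall n, N n -> s (h * n)%g = s' (h' * n)%g) ->
  dual N s h = dual N s' h'.
Proof.
move=> eq_s; apply/funext => a; congr (riesz D _); apply/funext => b.
apply: eq_fsbigr => n _.
have [Nn|Nn] := pselect (N n); last first.
  by rewrite valL_out // ![dform D _ 0]dformC !dform0l.
congr (dform D _ _); rewrite /shift !invgK; apply: eq_nuca; first exact: eq_s.
have fixE (g u : G) : (g * u == g)%g = (u == 1)%g.
  by rewrite -[X in _ == X]mulg1 (inj_eq (mulgI g)).
by move=> m _; rewrite /delta -!mulgA !fixE.
Qed.

Definition opposite M N := forall g, M g <-> N g^-1%g.

Lemma opposite_sym M N : opposite M N -> opposite N M.
Proof. by move=> MN g; rewrite MN invgK. Qed.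

Section Dual.
Variables (M N : set G) (s : G -> local_map A M).
Hypotheses (s_lin : linear_nuca s) (finM : finite_set M) (MN : opposite M N).

(** When [N] is opposite to [M], the configuration [nuca s (delta h b)] is
supported in [h N], so cutting [y] down to [h N] loses nothing. *)
Lemma pairing_delta_dual h b y :
  pairing (delta h b) (nuca (dual N s) y) = pairing (nuca s (delta h b)) y.
Proof.
have fin_delta b' : asymptotic (nuca s (delta h b')) 0.
  exact/asymptotic0_nuca/asymptotic0_delta.
have pairingE b' :
    pairing (shift h^-1%g (nuca s (delta h b')))
      (valL_ 0 (sigL N (shift h^-1%g y)))
    = pairing (nuca s (delta h b')) y.
  rewrite -[RHS](pairing_shift h^-1%g); apply: eq_fsbigr => n _.
  have [Nn|Nn] := pselect (N n); first by rewrite valL_sigL.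
  rewrite [shift _ (nuca _ _) n]linear_nuca_eq0 ?dform0l // => m Mm.
  rewrite invgK /delta; case: eqP => // hnm; case: Nn.
  have -> : n = (m^-1)%g.
    by apply/divg1_eq; rewrite invgK; apply: (mulgI h); rewrite mulgA hnm mulg1.
  exact/MN.
rewrite pairing_delta /nuca -/(nuca s) /dual.
under [X in riesz D X]funext do rewrite pairingE.
rewrite dform_riesz // => c b1 b2.
by rewrite delta_linear s_lin pairing_linl.
Qed.

Lemma pairing_dual x y : asymptotic x 0 ->
  pairing x (nuca (dual N s) y) = pairing (nuca s x) y.
Proof.
move: x; apply: asymptotic0_ind => [|h a x x0 IHx].
  by rewrite linear_nuca0 // !pairing0l.
have da0 := asymptotic0_delta h a.
rewrite s_lin !pairing_linl ?pairing_delta_dual ?IHx //;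
  exact: asymptotic0_nuca.
Qed.

Lemma dual_linear : linear_nuca (dual N s).
Proof.
move=> c x y; apply: pairing_inj => h b.
by rewrite pairing_linr ?pairing_delta_dual ?pairing_linr //;
  try apply: asymptotic0_nuca => //; exact: asymptotic0_delta.
Qed.

End Dual.

Lemma finite_opposite M N : opposite M N -> finite_set M -> finite_set N.
Proof.
move=> MN finM.
apply: sub_finite_set (finite_image (fun g => g^-1)%g finM) => n Nn.
by exists n^-1%g; [apply/MN; rewrite invgK|rewrite invgK].
Qed.

(** Both sides have the same transpose with respect to the pairing, hence agree
on finitely supported configurations; the memory being finite, these display
all local patterns. *)
Lemma dualK M N (s : G -> local_map A M) :
  linear_nuca s -> finite_set M -> opposite M N -> dual M (dual N s) = s.
Proof.
move=> s_lin finM MN; have NM := opposite_sym MN.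
have finN := finite_opposite MN finM.
have d_lin := dual_linear s_lin finM MN.
have ddE y : asymptotic y 0 -> nuca (dual M (dual N s)) y = nuca s y.
  move=> y0; apply: pairing_inj => h b.
  rewrite pairing_dual //; last exact: asymptotic0_delta.
  by rewrite pairingC pairing_dual // pairingC.
apply/funext => h; apply/funext => a.
pose y := shift h (valL_ 0 a : G -> A).
have y0 : asymptotic y 0.
  exists (set_mulg [set h] M).
    by apply: finite_set_mulg => //; exact: finite_set1.
  move=> g hMg; rewrite /y /shift valL_out // => Mg; apply: hMg.
  by exists h => //; exists (h^-1 * g)%g => //; rewrite mulVKg.
have ya : sigL M (shift h^-1%g y) = a.
  rewrite -[RHS](valLK 0); congr (sigL M _).
  by apply/funext => n; rewrite /y /shift invgK mulKg.
by have /(congr1 (@^~ h)) := ddE y y0; rewrite /nuca ya.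
Qed.

Lemma dual_comp M N M' N' (s : G -> local_map A M) (t : G -> local_map A M') :
  linear_nuca s -> finite_set M -> opposite M N ->
  linear_nuca t -> finite_set M' -> opposite M' N' ->
  nuca s \o nuca t = id -> nuca (dual N' t) \o nuca (dual N s) = id.
Proof.
move=> s_lin finM MN t_lin finM' MN' st; apply/funext => y.
apply: pairing_inj => h b; have d0 := asymptotic0_delta h b.
rewrite /= !pairing_dual //; last exact: asymptotic0_nuca.
by have /= -> := congr1 (@^~ (delta h b)) st.
Qed.

Lemma orbit_closure_dual M N (s p : G -> local_map A M) :
  finite_set N -> orbit_closure s p ->
  orbit_closure (dual N s) (dual N p).
Proof.
move=> finN /orbit_closureP clp; apply/orbit_closureP => E finE.
have [g gP] := clp _ (finite_set_mulg finE finN).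
exists g => h Eh; apply: dual_local => n Nn.
by rewrite gP ?/shift ?mulgA //; exists h => //; exists n.
Qed.

(** * Transposition of injectivity and post-surjectivity *)

(** A configuration is determined by its pairings with the configurations
[delta h b], and these are images of finitely supported configurations. *)
Lemma injective_dual M N (s : G -> local_map A M) :
  linear_nuca s -> finite_set M -> opposite M N ->
  post_surjective (nuca s) -> injective (nuca (dual N s)).
Proof.
move=> s_lin finM MN s_post y y' eq_d; apply: pairing_inj => h b.
have [|z z0 <-] := s_post 0 (delta h b).
  by rewrite linear_nuca0 //; exact: asymptotic0_delta.
by rewrite -!(pairing_dual s_lin finM MN) // eq_d.
Qed.

(** A functional killing the image of the finitely supported configurations is
represented by a configuration [y], and [nuca s y] is then orthogonal to all
finitely supported configurations. *)
Lemma post_surjective_dual M N (s : G -> local_map A M) :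
  linear_nuca s -> finite_set M -> opposite M N ->
  injective (nuca s) -> post_surjective (nuca (dual N s)).
Proof.
move=> s_lin finM MN s_inj.
have d_lin := dual_linear s_lin finM MN.
have finN := finite_opposite MN finM.
pose W : set (G -> A) :=
  [set nuca (dual N s) u | u in [set u | asymptotic u 0]].
have onto v : asymptotic v 0 -> W v.
  move=> v0; apply: contrapT => Wv.
  have [|||phi [phi_lin phiW phiv]] := @separating_functional k _ W v.
  - by exists 0; [exact: asymptotic00|rewrite linear_nuca0].
  - move=> c _ _ [u u0 <-] [u' u'0 <-]; exists (c *: u + u'); last exact: d_lin.
    exact: asymptotic0_lin.
  - exact: Wv.
  have phi0 : phi 0 = 0.
    by apply: phiW; exists 0; [exact: asymptotic00|rewrite linear_nuca0].
  pose y : G -> A := fun h => riesz D (fun b => phi (delta h b)).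
  have phiE x : asymptotic x 0 -> pairing x y = phi x.
    move: x; apply: asymptotic0_ind => [|h a x x0 IHx].
      by rewrite pairing0l.
    rewrite pairing_linl //; last exact: asymptotic0_delta.
    rewrite phi_lin IHx pairing_delta dform_riesz // => c b b'.
    by rewrite delta_linear phi_lin.
  have y0 : y = 0.
    apply: s_inj; rewrite linear_nuca0 //; apply: pairing_inj => h b.
    have d0 := asymptotic0_delta h b.
    rewrite -[in LHS](dualK s_lin finM MN) pairing_dual //; last first.
      exact: opposite_sym.
    rewrite phiE; last exact: asymptotic0_nuca.
    rewrite phiW; last by exists (delta h b).
    by rewrite pairingC pairing0l.
  have := phiE v v0; rewrite y0 pairingC pairing0l phiv => /eqP.
  by rewrite eq_sym oner_eq0.
move=> x y [E finE yE].
have [|u [F finF uF] du] := onto (-1 *: nuca (dual N s) x + y).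
  exists E => // g Eg; rewrite scaleN1r -[LHS]/(- nuca (dual N s) x g + y g).
  by rewrite yE // addNr.
exists (1 *: u + x).
  exists F => // g Fg; rewrite scale1r -[LHS]/(u g + x g) uF //.
  exact: add0r.
by rewrite d_lin du scale1r scaleN1r addrAC addNr add0r.
Qed.

(** [dual N s h] sees [s] on [h N]. If [h] is in [F Q E] but not in [F Q], where
[Q] contains the inverses of the elements of [N], then [h N] is in [F Q E N] and
avoids [F]. So the windows are enlarged to [Q E P], where [P] is the set of
inverses of [Q]: this contains [Q E N] and is symmetric. *)
Lemma uniformly_bounded_singularity_dual M N (s : G -> local_map A M) :
  finite_set N -> uniformly_bounded_singularity s ->
  uniformly_bounded_singularity (dual N s).
Proof.
move=> finN s_ubs E finE E1 EV.
pose P := N `|` [set 1%g]; pose Q := [set n^-1%g | n in P].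
have finP : finite_set P.
  by rewrite finite_setU; split => //; exact: finite_set1.
have finQ : finite_set Q := finite_image _ finP.
have P1 : P 1%g by right.
have Q1 : Q 1%g by exists 1%g => //; rewrite invg1.
have sub_mulg (X Y : set G) : Y 1%g -> X `<=` set_mulg X Y.
  by move=> Y1 g Xg; exists g => //; exists 1%g; rewrite ?mulg1.
pose E' := set_mulg (set_mulg Q E) P.
have [|||F [finF E'F [c cP]]] := s_ubs E'.
- by do 2?apply: finite_set_mulg.
- by exists 1%g; [exists 1%g => //; exists 1%g; rewrite ?mulg1|
    exists 1%g; rewrite ?mulg1].
- have E'V g : E' g -> E' g^-1%g.
    move=> [_ [_ [p Pp <-] [e Ee <-]] [p' Pp' <-]].
    exists (p'^-1 * e^-1)%g; last first.
      by exists p => //; rewrite !(invgM, invgK) mulgA.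
    by exists p'^-1%g; [exists p'|exists e^-1%g => //; rewrite EV; exists e].
  apply/seteqP; split=> [g /E'V E'g|_ [g /E'V E'g <-]] //.
  by exists g^-1%g; rewrite ?invgK.
exists (set_mulg F Q); split.
- exact: finite_set_mulg.
- move=> g Eg; apply: (sub_mulg _ _ Q1); apply/E'F/(sub_mulg _ _ P1).
  by exists 1%g => //; exists g; rewrite ?mul1g.
- exists (dual N (fun=> c) 1%g) => h [[_ [f Ff [q Qq <-]] [e Ee <-]] hF].
  apply: dual_local => n Nn; apply: cP; split.
    exists f => //; exists (q * e * n)%g; last by rewrite !mulgA.
    by exists (q * e)%g; [exists q => //; exists e|exists n => //; left].
  move=> Fhn; apply: hF; exists (f * q * e * n)%g => //.
  by exists n^-1%g; [exists n => //; left|rewrite mulgK].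
Qed.

(** * Transposition of the stable properties *)

Lemma stably_injective_dual M N (s : G -> local_map A M) :
  linear_nuca s -> finite_set M -> opposite M N ->
  stably_post_surjective s -> stably_injective (dual N s).
Proof.
move=> s_lin finM MN s_post p clp.
have finN := finite_opposite MN finM.
have p_lin := linear_nuca_orbit_closure (dual_linear s_lin finM MN) clp.
have := orbit_closure_dual finM clp; rewrite dualK // => clq.
rewrite -(dualK p_lin finN (opposite_sym MN)).
apply: injective_dual => //; last exact: s_post.
exact: linear_nuca_orbit_closure clq.
Qed.

Lemma stably_post_surjective_dual M N (s : G -> local_map A M) :
  linear_nuca s -> finite_set M -> opposite M N ->
  stably_injective s -> stably_post_surjective (dual N s).
Proof.
move=> s_lin finM MN s_inj p clp.
have finN := finite_opposite MN finM.
have p_lin := linear_nuca_orbit_closure (dual_linear s_lin finM MN) clp.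
have := orbit_closure_dual finM clp; rewrite dualK // => clq.
rewrite -(dualK p_lin finN (opposite_sym MN)).
apply: post_surjective_dual => //; last exact: s_inj.
exact: linear_nuca_orbit_closure clq.
Qed.

(** The transpose is inverted by some [q], linear as the inverse of a linear
map; the transpose of [q] inverts [nuca s]. *)
Lemma stably_invertible_of_dual M N (s : G -> local_map A M) :
  linear_nuca s -> finite_set M -> opposite M N ->
  stably_invertible (dual N s) -> stably_invertible s.
Proof.
move=> s_lin finM MN [L [finL [t tP]]].
have [q _ [dq qd]] := tP _ (@orbit_closure_refl _ _ (dual N s)).
have finN := finite_opposite MN finM; have NM := opposite_sym MN.
have d_lin := dual_linear s_lin finM MN.
have q_lin := linear_nuca_inv d_lin dq qd.
pose K := [set l^-1%g | l in L].
have LK : opposite L K.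
  move=> g; split=> [Lg|[l Ll /invg_inj <-]] //.
  by exists g.
apply: (@stably_invertible_of_inverse _ _ _ _ s (dual K q)) => //.
- exact: finite_opposite finL.
- by have := dual_comp q_lin finL LK d_lin finN NM qd; rewrite dualK.
- by have := dual_comp d_lin finN NM q_lin finL LK dq; rewrite dualK.
Qed.

End LinearAutomata.

Theorem proposition1p7 (G : groupType) (k : fieldType) (A : finLmodType k)
    (hG : finitely_generated G) :
  (forall (M : set G) (s : G -> local_map A M),
     finite_set M -> linear_nuca s -> uniformly_bounded_singularity s ->
     stably_injective s -> stably_invertible s)
  <->
  (forall (M : set G) (s : G -> local_map A M),
     finite_set M -> linear_nuca s -> uniformly_bounded_singularity s ->
     stably_post_surjective s -> stably_invertible s).
Proof.
have [D _] := finLmod_self_duality A.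
have oppV (M : set G) : opposite M [set m^-1%g | m in M].
  by move=> g; split=> [Mg|[m Mm /invg_inj <-]] //; exists g.
split=> inv M s finM s_lin s_ubs s_stable; have MN := oppV M;
  have finN := finite_opposite MN finM;
  apply: (stably_invertible_of_dual (D := D) s_lin finM MN);
  apply: inv => //.
- exact: dual_linear.
- exact: uniformly_bounded_singularity_dual.
- exact: stably_injective_dual.
- exact: dual_linear.
- exact: uniformly_bounded_singularity_dual.
- exact: stably_post_surjective_dual.
Qed.
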